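(* Let $p>0$ be a prime and let $(R,\mathfrak{m},K)$ be a standard graded $K$-algebra over a field $K$ of characteristic $p$, such that $R$ is $F$-finite and $F$-pure. Then ${\operatorname{fpt}}(R)\leq -a_i(R)$ for every $i\in\mathbb{N}$.
   Context: A standard graded $K$-algebra $(R,\mathfrak{m},K)$ is a Noetherian ring $R=\bigoplus_{i\geq 0}R_i$ with $R_iR_j\subseteq R_{i+j}$, $R_0=K$ a field, $\dim_K R_1<\infty$ and $R=K[R_1]$; $\mathfrak{m}=\bigoplus_{i\geq 1}R_i$. $R$ is $F$-finite if $R$ is finitely generated as a module over itself via Frobenius (equivalently $[K:K^p]<\infty$); $R$ is $F$-pure if the Frobenius map $R\to R$ is pure (for $F$-finite $R$ this is equivalent to $R\hookrightarrow R^{1/p}$ splitting as $R$-modules); $F$-pure rings are reduced. For $i\in\mathbb{N}$, $a_i(R)=\max\{\alpha\in\mathbb{Z} : H^i_\mathfrak{m}(R)_\alpha\neq 0\}$ if $H^i_\mathfrak{m}(R)\neq 0$ and $a_i(R)=-\infty$ otherwise, where $H^i_\mathfrak{m}(R)$ is the (graded) local cohomology. For a homogeneous ideal $I$ and real $\lambda\geq 0$, the pair $(R,I^\lambda)$ is $F$-pure if for every $e\gg 0$ there is $f\in I^{\lfloor (p^e-1)\lambda\rfloor}$ such that the $R$-module inclusion $f^{1/p^e}R\subseteq R^{1/p^e}$ splits. ${\operatorname{fpt}}(I)=\sup\{\lambda\geq 0 : (R,I^\lambda)\text{ is }F\text{-pure}\}$ and ${\operatorname{fpt}}(R)={\operatorname{fpt}}(\mathfrak{m})$.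 The inequality is trivially true when $a_i(R)=-\infty$. *)

(* Defs.v *)
From HB Require Import structures.
From mathcomp Require Import all_boot all_order all_algebra.
From mathcomp Require Import reals ereal Rstruct.
From Stdlib Require Rdefinitions.
Notation R := Rdefinitions.R.

Set Implicit Arguments.
Unset Strict Implicit.
Unset Printing Implicit Defensive.

Import Order.TTheory GRing.Theory Num.Theory.
Local Open Scope ring_scope.

Section Graded.
Variables (K : fieldType) (A : comAlgType K).

Inductive addclos (P : A -> Prop) : A -> Prop :=
| addclos0 : addclos P 0
| addclos_in x : P x -> addclos P x
| addclosD x y : addclos P x -> addclos P y -> addclos P (x + y).

Definition is_ideal (I : A -> Prop) : Prop :=
  I 0 /\ (forall x y, I x -> I y -> I (x + y)) /\ (forall r x, I x -> I (r * x)).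

Fixpoint ideal_pow (I : A -> Prop) (k : nat) : A -> Prop :=
  match k with
  | 0 => fun _ => True
  | k'.+1 => addclos (fun r => exists a b, ideal_pow I k' a /\ I b /\ r = a * b)
  end.

Definition noetherian : Prop :=
  forall I : nat -> A -> Prop, (forall n, is_ideal (I n)) ->
    (forall n x, I n x -> I n.+1 x) ->
    exists N : nat, forall (n : nat) x, (N <= n)%N -> I n x -> I N x.

Inductive gen_alg (S : A -> Prop) : A -> Prop :=
| gen_in x : S x -> gen_alg S x
| gen_scal (k : K) : gen_alg S (k%:A)
| gen_add x y : gen_alg S x -> gen_alg S y -> gen_alg S (x + y)
| gen_mul x y : gen_alg S x -> gen_alg S y -> gen_alg S (x * y).

(* pi d r is the homogeneous component of degree d of r, so that A_d = image of pi d *)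
Variable pi : nat -> A -> A.

Definition homog (d : nat) (r : A) : Prop := pi d r = r.

Definition homogz (d : int) (r : A) : Prop :=
  match d with
  | Posz n => homog n r
  | Negz _ => r = 0
  end.

Definition in_span n (xs : 'I_n -> A) (r : A) : Prop :=
  exists c : 'I_n -> K, r = \sum_(j < n) c j *: xs j.

Definition standard_graded : Prop :=
  (* A = (+)_{i >= 0} A_i as K-vector spaces *)
  (forall d x y, pi d (x + y) = pi d x + pi d y) /\
  (forall d (k : K) x, pi d (k *: x) = k *: pi d x) /\
  (forall d e r, pi d (pi e r) = if d == e then pi e r else 0) /\
  (forall r, exists N : nat, (forall d : nat, (N <= d)%N -> pi d r = 0) /\
                       r = \sum_(d < N) pi d r) /\
  (forall d e r s, homog d r -> homog e s -> homog (d + e) (r * s)) /\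
  (forall r, homog 0 r <-> exists k : K, r = k%:A) /\
  (exists n (xs : 'I_n -> A), (forall j, homog 1 (xs j)) /\
     forall r, homog 1 r -> in_span xs r) /\
  (forall r, gen_alg (homog 1) r) /\
  noetherian.

Definition irrelevant_ideal (r : A) : Prop := pi 0 r = 0.

Variable p : nat.

(* an R-linear map R^{1/p^e} -> R, seen as a map phi : A -> A with
   phi (r^(p^e) s) = r phi(s) *)
Definition plinear (e : nat) (phi : A -> A) : Prop :=
  (forall x y, phi (x + y) = phi x + phi y) /\
  (forall r s, phi (r ^+ (p ^ e) * s) = r * phi s).

Definition F_finite : Prop :=
  exists (n : nat) (s : 'I_n -> A), forall r, exists c : 'I_n -> A,
    r = \sum_(j < n) c j ^+ p * s j.

(* F-pure (for F-finite rings): A -> A^{1/p} splits *)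
Definition F_pure : Prop :=
  exists phi, plinear 1 phi /\ phi 1 = 1.

(* the pair (A, I^lam) is F-pure: for every e >> 0 there is
   f in I^{floor((p^e - 1) lam)} such that A -> A^{1/p^e}, 1 |-> f^{1/p^e}
   splits *)
Definition pair_F_pure (I : A -> Prop) (lam : R) : Prop :=
  exists e0 : nat, forall e : nat, (e0 <= e)%N ->
    exists f, ideal_pow I (Num.truncn (((p ^ e)%:R - 1) * lam)) f /\
      exists phi, plinear e phi /\ phi f = 1.

Definition fpt_ideal (I : A -> Prop) : \bar R :=
  ereal_sup (fun x : \bar R =>
    exists lam : R, [/\ 0 <= lam, pair_F_pure I lam & x = lam%:E]).

Definition fpt : \bar R := fpt_ideal irrelevant_ideal.

(* Fix x_0, ..., x_{n-1} in A_1 generating m.  For J a set of indices,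
   x_J = prod_{j in J} x_j.  A homogeneous Cech i-cochain of degree alpha is
   represented by (c, k): its J-component (|J| = i) is c J / x_J^k in A_{x_J},
   with c J homogeneous of degree alpha + k |J|. *)
Section Cech.
Variables (n : nat) (xs : 'I_n -> A).

Definition xJ (J : {set 'I_n}) : A := \prod_(j in J) xs j.

(* equality in the localization A_{x_J} of a/x_J^k and b/x_J^l *)
Definition loc_eq (J : {set 'I_n}) (a : A) (k : nat) (b : A) (l : nat) : Prop :=
  exists N, xJ J ^+ N * (a * xJ J ^+ l - b * xJ J ^+ k) = 0.

Definition cochain_homog (i : nat) (alpha : int) (c : {set 'I_n} -> A) (k : nat) :=
  forall J : {set 'I_n}, #|J| = i -> homogz (alpha + (k * i)%N%:Z) (c J).

(* numerator of (d c)_J over x_J^k, for |J| = i+1: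
   sum_t (-1)^t c(J \ j_t) x_{j_t}^k, j_0 < ... < j_i the elements of J *)
Definition cech_d_num (c : {set 'I_n} -> A) (k : nat) (J : {set 'I_n}) : A :=
  \sum_(j in J) (-1) ^+ #|[set j' in J | (j' < j)%N]| * c (J :\ j) * xs j ^+ k.

Definition cech_cocycle (i : nat) (c : {set 'I_n} -> A) (k : nat) : Prop :=
  forall J : {set 'I_n}, #|J| = i.+1 -> loc_eq J (cech_d_num c k J) k 0 0.

Definition cech_coboundary (i : nat) (alpha : int) (c : {set 'I_n} -> A) (k : nat) :=
  match i with
  | 0 => forall J : {set 'I_n}, #|J| = 0 -> loc_eq J (c J) k 0 0
  | i'.+1 => exists (b : {set 'I_n} -> A) (l : nat), cochain_homog i' alpha b l /\
      forall J : {set 'I_n}, #|J| = i -> loc_eq J (c J) k (cech_d_num b l J) l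
  end.

Definition cech_nonzero (i : nat) (alpha : int) : Prop :=
  exists (c : {set 'I_n} -> A) (k : nat),
    cochain_homog i alpha c k /\ cech_cocycle i c k /\ ~ cech_coboundary i alpha c k.
End Cech.

Definition loccoh_nonzero (i : nat) (alpha : int) : Prop :=
  exists n (xs : 'I_n -> A), (forall j, homog 1 (xs j)) /\
    (forall r, homog 1 r -> in_span xs r) /\ cech_nonzero xs i alpha.

(* a_i(A) = max{alpha | H^i_m(A)_alpha <> 0}, and -oo if H^i_m(A) = 0 *)
Definition a_inv (i : nat) : \bar R :=
  ereal_sup (fun x : \bar R =>
    exists alpha : int, loccoh_nonzero i alpha /\ x = (alpha%:~R : R)%:E).

End Graded.

(* Main.v *)
(* Let f in m^s, with s = floor((p^e - 1) lam), be such that phi(f) = 1 for some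
   R-linear phi : R^{1/p^e} -> R.  Then z |-> f F^e(z) is injective on H^i_m(R), and it
   sends degree alpha to degrees >= p^e alpha + s.  If lam + alpha > 0 these degrees tend
   to infinity with e, so it suffices that H^i_m(R) vanishes in large degrees.

   The vanishing goes through Koszul complexes.  The Koszul cohomology of x_1, ..., x_n
   is finitely generated and killed by m, hence it vanishes above some degree t.  Passing
   from x_j^m to x_j^(m+1) only adds classes coming from the Koszul complex on x_j shifted
   down by m, so the same t works for all powers x_1^{k_1}, ..., x_n^{k_n}, and therefore
   for their direct limit H^i_m(R).  Cochains of all cohomological degrees are treated at
   once, as families indexed by the subsets J of {1, ..., n}. *)
Require Import Defs.
From HB Require Import structures.
From mathcomp Require Import all_boot all_order all_algebra.
From mathcomp Require Import reals ereal Rstruct.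
From mathcomp Require Import zify ring lra.

Import Order.TTheory GRing.Theory Num.Theory.
Local Open Scope ring_scope.

Set Implicit Arguments.
Unset Strict Implicit.

(** * Ascending chains of submodules of a finite free module *)

Section NoetherianModule.
Variables (K : fieldType) (A : comAlgType K) (I : finType).

Definition submodule (M : (I -> A) -> Prop) : Prop :=
  [/\ forall v, (forall i, v i = 0) -> M v,
      forall v w u, M v -> M w -> (forall i, u i = v i + w i) -> M u
    & forall r v u, M v -> (forall i, u i = r * v i) -> M u].

(* The r-th coordinates of the vectors of M whose first r coordinates vanish form
   an ideal; these finitely many ideals control the chain. *)
Lemma noetherian_submodule_chain (M : nat -> (I -> A) -> Prop) :
    noetherian A -> (forall t, submodule (M t)) ->
    (forall t v, M t v -> M t.+1 v) ->
  exists N : nat, forall t v, (N <= t)%N -> M t v -> M N v.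
Proof.
move=> noeth subM incM.
have leM s t v : (s <= t)%N -> M s v -> M t v.
  move=> /subnK <-; elim: (t - s)%N => [|u IH] // Mv.
  by rewrite addSn; apply/incM/IH.
pose below r (v : I -> A) := forall i : I, (enum_rank i < r)%N -> v i = 0.
(* Induction on the number [r] of trailing coordinates that may be nonzero. *)
have stab r : (r <= #|I|)%N ->
    exists N : nat, forall t v, (N <= t)%N -> below (#|I| - r)%N v -> M t v -> M N v.
  elim: r => [_|r IH ltr].
    exists 0%N => t v _ b _; have [M0 _ _] := subM 0%N.
    by apply: M0 => i; apply: b; rewrite subn0 ltn_ord.
  have [N1 stab1] := IH (ltnW ltr).
  have lt_i : (#|I| - r.+1 < #|I|)%N by lia.
  pose i0 := enum_val (Ordinal lt_i).
  have rank_i0 : enum_rank i0 = (#|I| - r.+1)%N :> nat by rewrite enum_valK.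
  pose L t a := exists v, [/\ M t v, below (#|I| - r.+1)%N v & v i0 = a].
  have idealL t : is_ideal (L t).
    have [M0 MD MZ] := subM t; split; last split.
    - by exists (fun=> 0); split=> //; apply: M0.
    - move=> _ _ [v [Mv bv <-]] [w [Mw bw <-]].
      exists (fun i => v i + w i); split=> //; first exact: MD Mv Mw _.
      by move=> i lti; rewrite bv // bw // addr0.
    - move=> s _ [v [Mv bv <-]].
      exists (fun i => s * v i); split=> //; first exact: MZ Mv _.
      by move=> i lti; rewrite bv // mulr0.
  have incL t a : L t a -> L t.+1 a.
    by move=> [v [Mv bv <-]]; exists v; split=> //; apply: incM.
  have [N2 stab2] := noeth L idealL incL.
  exists (maxn N1 N2) => t v let_ bv Mv.
  (* Subtracting a [w] with the same [i0]-coordinate makes one more coordinate vanish. *)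
  have [w [Mw bw wv]] : L N2 (v i0).
    by apply: stab2 (leq_trans (leq_maxr _ _) let_) _; exists v.
  have [_ MD MZ] := subM t; have [_ MD' _] := subM (maxn N1 N2).
  apply: (MD' (fun i => v i - w i) w); last by move=> i; rewrite subrK.
    apply: (leM _ _ _ (leq_maxl _ _)).
    apply: (stab1 t) => [||].
    - exact: leq_trans (leq_maxl _ _) let_.
    - move=> i lti; case: (ltnP (enum_rank i) (#|I| - r.+1)) => [lt|ge].
        by rewrite bv // bw // subr0.
      suff -> : i = i0 by rewrite wv subrr.
      apply: enum_rank_inj; apply: ord_inj; rewrite rank_i0.
      apply/eqP; rewrite eqn_leq ge andbT -ltnS.
      by rewrite -subSn // in lti *.
    - apply: (MD v (fun i => -1 * w i)) => //; last by move=> i; rewrite mulN1r.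
      apply: (MZ (-1) w) => //.
      exact: leM (leq_trans (leq_maxr _ _) let_) Mw.
  exact: leM (leq_maxr _ _) Mw.
have [N stabN] := stab #|I| (leqnn _).
by exists N => t v le_t; apply: stabN => // i; rewrite subnn.
Qed.

End NoetherianModule.

(** * Homogeneous components in integer degrees *)

Section GradedRing.
Variables (K : fieldType) (A : comAlgType K) (pi : nat -> A -> A).
Hypothesis sgA : standard_graded pi.

Definition piz (z : int) (r : A) : A := if z is Posz d then pi d r else 0.

Lemma piD d x y : pi d (x + y) = pi d x + pi d y.
Proof. by case: sgA. Qed.

Lemma pi0 d : pi d 0 = 0.
Proof. by apply: (addrI (pi d 0)); rewrite -piD !addr0. Qed.

Lemma pi_pi d e r : pi d (pi e r) = if d == e then pi e r else 0.
Proof. by case: sgA => _ [_ []]. Qed.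

Lemma pi_decomp r :
  exists N : nat, (forall d : nat, (N <= d)%N -> pi d r = 0) /\ r = \sum_(d < N) pi d r.
Proof. by case: sgA => _ [_ [_ []]]. Qed.

Lemma pizD z x y : piz z (x + y) = piz z x + piz z y.
Proof. by case: z => d /=; rewrite ?piD ?addr0. Qed.

Lemma piz0 z : piz z 0 = 0.
Proof. by case: z => d /=; rewrite ?pi0. Qed.

Lemma pizN z x : piz z (- x) = - piz z x.
Proof. by apply/eqP; rewrite -addr_eq0 -pizD addNr piz0. Qed.

Lemma piz_sum z (J : Type) (s : seq J) (P : pred J) F :
  piz z (\sum_(j <- s | P j) F j) = \sum_(j <- s | P j) piz z (F j).
Proof. by elim/big_rec2: _ => [|j y1 y2 _ <-]; rewrite ?piz0 ?pizD. Qed.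

Lemma piz_sign z m x : piz z ((-1) ^+ m * x) = (-1) ^+ m * piz z x.
Proof. by rewrite -(signr_odd A m); case: odd; rewrite ?mulN1r ?mul1r // pizN. Qed.

Lemma homogzE z r : homogz pi z r <-> piz z r = r.
Proof. by case: z => d //=; split. Qed.

Lemma homogz_piz z r : homogz pi z (piz z r).
Proof. by case: z => d //=; rewrite /homog pi_pi eqxx. Qed.

Lemma piz_piz a b r : piz a (piz b r) = if a == b then piz b r else 0.
Proof.
case: b => b; last by rewrite piz0 if_same.
by case: a => a /=; rewrite ?pi_pi.
Qed.

Lemma piz_homogz a b r : homogz pi a r -> piz b r = if b == a then r else 0.
Proof. by move=> /homogzE <-; rewrite piz_piz. Qed.

Lemma homogz0 z : homogz pi z 0.
Proof. by apply/homogzE; rewrite piz0. Qed.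

Lemma homogz_sign z m x : homogz pi z x -> homogz pi z ((-1) ^+ m * x).
Proof. by move=> /homogzE hx; apply/homogzE; rewrite piz_sign hx. Qed.

Lemma homogzM a b x y : homogz pi a x -> homogz pi b y -> homogz pi (a + b) (x * y).
Proof.
case: a => a hx; last by rewrite hx mul0r => _; apply: homogz0.
case: b => b hy; last by rewrite hy mulr0; apply: homogz0.
by case: sgA => _ [_ [_ [_ [hM _]]]]; apply: hM.
Qed.

Lemma homogz1 : homogz pi 0 1.
Proof.
case: sgA => _ [_ [_ [_ [_ [h0 _]]]]].
by apply/h0; exists 1; rewrite scale1r.
Qed.

Lemma homogzX a x m : homogz pi a x -> homogz pi (a *+ m) (x ^+ m).
Proof.
move=> hx; elim: m => [|m IH]; first exact: homogz1.
by rewrite mulrS exprS; apply: homogzM.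
Qed.

Lemma homogz_prod (J : finType) (P : pred J) (a : J -> int) (F : J -> A) :
  (forall j, P j -> homogz pi (a j) (F j)) ->
  homogz pi (\sum_(j | P j) a j) (\prod_(j | P j) F j).
Proof.
move=> hF; elim/big_rec2: _ => [|j y1 y2 Pj IH]; first exact: homogz1.
exact: homogzM (hF j Pj) IH.
Qed.

Lemma piz_mulr z m b y : homogz pi m y -> piz (z + m) (b * y) = piz z b * y.
Proof.
move=> hy; have [N [_ ->]] := pi_decomp b.
rewrite mulr_suml !piz_sum mulr_suml; apply: eq_bigr => d _.
have hd : homogz pi d (pi d b) by exact: (homogz_piz d).
rewrite (piz_homogz z hd) (piz_homogz (z + m) (homogzM hd hy)).
rewrite (inj_eq (addIr m)); case: ifP => //; by rewrite mul0r.
Qed.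

(** In a product from [m^s] times [m], the second factor has no degree 0 part, so the first would
    have to contribute in degree below [s]. *)
Lemma ideal_pow_low_degree s f d :
  ideal_pow (irrelevant_ideal pi) s f -> (d < s)%N -> pi d f = 0.
Proof.
elim: s f d => [|s IH] f d //=.
elim=> [|_ [a [b [Ia [Ib ->]]]]|x y _ IHx _ IHy] ltd.
- exact: pi0.
- have [N [_ ->]] := pi_decomp b.
  rewrite mulr_sumr -[LHS]/(piz d _) piz_sum big1 // => e _.
  have he : homogz pi e (pi e b) by exact: (homogz_piz e).
  have -> : d%:Z = (d%:Z - e%:Z) + e%:Z by rewrite subrK.
  rewrite piz_mulr //; case: (posnP e) => [-> | e_gt0]; first by rewrite Ib mulr0.
  case E: (d%:Z - e%:Z) => [c|c] /=; rewrite ?mul0r //.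
  by rewrite (IH a c) ?mul0r //; lia.
- by rewrite piD IHx // IHy // addr0.
Qed.

(** * The Koszul complex on generators of degree one *)

Section Koszul.
Variables (n : nat) (xs : 'I_n -> A).
Hypothesis xs1 : forall j, homog pi 1 (xs j).
Hypothesis xs_span : forall r, homog pi 1 r -> in_span xs r.

(** Since degree one generates the algebra, each [r] is a scalar plus a combination of the [xs j];
    the scalar drops out in positive degree. *)
Lemma piz_irrelevant z r : 0 < z -> exists a : 'I_n -> A, piz z r = \sum_j a j * xs j.
Proof.
have [_ [_ [_ [_ [_ [h0 [_ [gen _]]]]]]]] := sgA.
have [k [a ->]] : exists k (a : 'I_n -> A), r = k%:A + \sum_j a j * xs j.
  elim: (gen r) => [x /xs_span [c ->]|k|x y _ [k [a ->]] _ [l [b ->]]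
                   |x y _ [k [a ->]] _ [l [b ->]]].
  - exists 0, (fun j => (c j)%:A); rewrite scale0r add0r.
    by apply: eq_bigr => j _; rewrite -scalerAl mul1r.
  - by exists k, (fun=> 0); rewrite big1 ?addr0 // => j _; rewrite mul0r.
  - exists (k + l), (fun j => a j + b j); rewrite scalerDl addrACA -big_split /=.
    by congr (_ + _); apply: eq_bigr => j _; rewrite mulrDl.
  - exists (k * l), (fun j => k%:A * b j + a j * (l%:A + \sum_j b j * xs j)).
    rewrite mulrDl [k%:A * _]mulrDr -scalerAl mul1r scalerA -addrA.
    congr (_ + _); rewrite mulr_sumr mulr_suml -big_split /=.
    by apply: eq_bigr => j _; rewrite mulrDl !mulrA; congr (_ + _); rewrite mulrAC.
move=> z_gt0; exists (fun j => piz (z - 1) (a j)).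
have hk : homogz pi 0 (k%:A) by apply/h0; exists k.
rewrite pizD (piz_homogz z hk) gt_eqF // add0r piz_sum.
apply: eq_bigr => j _.
by rewrite -(piz_mulr (z - 1) (a j) (xs1 j : homogz pi 1 (xs j))) subrK.
Qed.

Definition below_card (j : 'I_n) (J : {set 'I_n}) : nat :=
  #|[set j' in J | (j' < j)%N]|.

(** Left multiplication by the sum of the [y_j e_j] on the exterior algebra, [c J] being the
    coefficient of [e_J]. *)
Definition koszul_d (y : 'I_n -> A) (c : {set 'I_n} -> A) (J : {set 'I_n}) : A :=
  \sum_(j in J) (-1) ^+ below_card j J * c (J :\ j) * y j.

(** The shift by [k] makes the differential on elements [y_j] of degree [k j] preserve [z]. *)
Definition homog_cochain (k : 'I_n -> nat) (z : int) (c : {set 'I_n} -> A) : Prop :=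
  forall J : {set 'I_n}, homogz pi (z + (\sum_(j in J) k j)%N%:Z) (c J).

Lemma below_card_setD1 (j l : 'I_n) (J : {set 'I_n}) :
  l \in J -> below_card j J = ((l < j) + below_card j (J :\ l))%N.
Proof.
move=> lJ; rewrite /below_card (cardsD1 l) inE lJ /=; congr (_ + _)%N.
by apply: eq_card => i; rewrite !inE andbA.
Qed.

Lemma mulr_sign_sign m : (-1) ^+ m * (-1) ^+ m = 1 :> A.
Proof. by rewrite -expr2 sqrr_sign. Qed.

(** Exactly one of [l < j] and [j < l] holds, so swapping the two removals changes the total count
    by an odd number. *)
Lemma koszul_sign (j l : 'I_n) (J : {set 'I_n}) : j \in J -> l \in J -> l != j ->
  (-1) ^+ below_card l J * (-1) ^+ below_card j (J :\ l) =
    - ((-1) ^+ below_card j J * (-1) ^+ below_card l (J :\ j)) :> A.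
Proof.
move=> jJ lJ; rewrite -(inj_eq val_inj) /= neq_ltn => ltjl.
rewrite (below_card_setD1 l jJ) (below_card_setD1 j lJ) !exprD.
case: ltngtP ltjl => //= _ _; ring.
Qed.

Lemma koszul_dD1 y c (j : 'I_n) (J : {set 'I_n}) : j \in J ->
  koszul_d y c J = (-1) ^+ below_card j J * c (J :\ j) * y j +
    \sum_(l in J | l != j) (-1) ^+ below_card l J * c (J :\ l) * y l.
Proof. by move=> jJ; rewrite /koszul_d (bigD1 j). Qed.

Lemma eq_koszul_d y y' c c' (J : {set 'I_n}) :
    (forall j, j \in J -> y j = y' j) -> (forall j, j \in J -> c (J :\ j) = c' (J :\ j)) ->
  koszul_d y c J = koszul_d y' c' J.
Proof. by move=> ey ec; apply: eq_bigr => j jJ; rewrite ey // ec. Qed.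

Lemma koszul_d_linear y (T : finType) (a : T -> A) (c : T -> {set 'I_n} -> A) J :
  koszul_d y (fun J' => \sum_t a t * c t J') J = \sum_t a t * koszul_d y (c t) J.
Proof.
under [RHS]eq_bigr do rewrite mulr_sumr.
rewrite exchange_big; apply: eq_bigr => j _ /=.
by rewrite mulr_sumr mulr_suml; apply: eq_bigr => t _; ring.
Qed.

Lemma koszul_dD y c c' J :
  koszul_d y (fun J' => c J' + c' J') J = koszul_d y c J + koszul_d y c' J.
Proof. by rewrite -big_split; apply: eq_bigr => j _ /=; ring. Qed.

Lemma sum_setD1 (k : 'I_n -> nat) (j : 'I_n) (J : {set 'I_n}) : j \in J ->
  (\sum_(l in J) k l = k j + \sum_(l in J :\ j) k l)%N.
Proof. by move=> jJ; rewrite (big_setD1 j). Qed.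

(** The differential is homogeneous, so the degree [z] part of any primitive is again a
    primitive. *)
Lemma koszul_d_proj (k : 'I_n -> nat) y z c b :
    (forall j, homogz pi (k j) (y j)) -> homog_cochain k z c ->
    (forall J, c J = koszul_d y b J) ->
  exists2 b', homog_cochain k z b' & forall J, c J = koszul_d y b' J.
Proof.
move=> hy hc cE.
exists (fun J : {set 'I_n} => piz (z + (\sum_(j in J) k j)%N%:Z) (b J)) => J.
  exact: homogz_piz.
have /homogzE <- := hc J; rewrite cE piz_sum; apply: eq_bigr => j jJ.
rewrite -mulrA piz_sign (sum_setD1 k jJ) addnC PoszD addrA.
by rewrite (piz_mulr _ _ (hy j)) mulrA.
Qed.

(** Contraction with the dual of [e_j]. *)
Definition koszul_homotopy (j : 'I_n) (c : {set 'I_n} -> A) (J : {set 'I_n}) : A :=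
  if j \in J then 0 else (-1) ^+ below_card j (j |: J) * c (j |: J).

(** Contraction is a homotopy from multiplication by [y j] to zero, so [y j] kills the
    cohomology. *)
Lemma koszul_homotopyP y c j J : (forall J', koszul_d y c J' = 0) ->
  koszul_d y (koszul_homotopy j c) J = y j * c J.
Proof.
move=> dc; have [jJ|jJ] := boolP (j \in J).
  rewrite (koszul_dD1 _ _ jJ) big1 ?addr0 => [|l /andP [lJ lj]].
    rewrite /koszul_homotopy setD11 setD1K //.
    by rewrite mulrA mulr_sign_sign mul1r mulrC.
  by rewrite /koszul_homotopy in_setD1 eq_sym lj jJ mulr0 mul0r.
have jjJ : j \in j |: J by rewrite setU11.
(* The cocycle condition at [j |: J] is solved for its term in [c J]. *)
have := dc (j |: J); rewrite (koszul_dD1 _ _ jjJ) setU1K // => /eqP.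
rewrite addr_eq0 => /eqP E.
have -> : y j * c J = (-1) ^+ below_card j (j |: J) *
    ((-1) ^+ below_card j (j |: J) * c J * y j).
  by rewrite !mulrA mulr_sign_sign mul1r mulrC.
rewrite E mulrN mulr_sumr -sumrN.
apply: eq_big => [l|l lJ].
  by rewrite in_setU1; case: eqP => [->|] //=; rewrite ?(negPf jJ) // andbT.
have lj : l != j by apply: contraNneq jJ => <-.
have ljJ : l \in j |: J by rewrite in_setU1 lJ orbT.
have DU : j |: (J :\ l) = (j |: J) :\ l.
  by apply/setP => i; rewrite !inE; case: (i =P j) => [->|] //=; rewrite eq_sym lj.
rewrite /koszul_homotopy in_setD1 (negPf jJ) andbF DU.
have := koszul_sign jjJ ljJ lj; rewrite setU1K // => S.
have -> : (-1) ^+ below_card l J = - ((-1) ^+ below_card j (j |: J) *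
   ((-1) ^+ below_card l (j |: J) * (-1) ^+ below_card j ((j |: J) :\ l))) :> A.
  by rewrite S mulrN opprK mulrA mulr_sign_sign mul1r.
set s := (-1) ^+ below_card j ((j |: J) :\ l).
have ss : s * s = 1 by exact: mulr_sign_sign.
ring: ss.
Qed.

(** The submodule generated by the homogeneous cocycles of degree at most [t]; stabilization of this
    chain replaces a choice of finitely many generators. *)
Inductive cocycle_span (t : nat) : ({set 'I_n} -> A) -> Prop :=
| cocycle_span0 v : (forall J, v J = 0) -> cocycle_span t v
| cocycle_spanD v w r z (d : int) : cocycle_span t w -> d <= t%:Z ->
    homog_cochain (fun=> 1%N) d z -> (forall J, koszul_d xs z J = 0) ->
    (forall J, v J = r * z J + w J) -> cocycle_span t v.

Lemma cocycle_span_submodule t : submodule (cocycle_span t).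
Proof.
split=> [||s v u Hv]; first exact: cocycle_span0.
  move=> v w u Hv Hw; elim: Hv u => {v} [v v0|v v' r z d _ IH led hz dz vE] u uE.
    elim: Hw u uE => {w} [w w0|w w' r z d _ IH led hz dz wE] u uE.
      by apply: cocycle_span0 => J; rewrite uE v0 w0 addr0.
    apply: (cocycle_spanD (r := r) _ led hz dz); first exact: (IH (fun J => v J + w' J)).
    by move=> J; rewrite uE v0 wE !add0r.
  apply: (cocycle_spanD (r := r) _ led hz dz); first exact: (IH (fun J => v' J + w J)).
  by move=> J; rewrite uE vE addrA.
elim: Hv u => {v} [v v0|v v' r z d _ IH led hz dz vE] u uE.
  by apply: cocycle_span0 => J; rewrite uE v0 mulr0.
apply: (cocycle_spanD (r := s * r) _ led hz dz); first exact: (IH (fun J => s * v' J)).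
by move=> J; rewrite uE vE mulrDr mulrA.
Qed.

Lemma cocycle_spanS t v : cocycle_span t v -> cocycle_span t.+1 v.
Proof.
elim=> {v} [v v0|v w r z d _ IH led hz dz vE]; first exact: cocycle_span0.
by apply: (cocycle_spanD (r := r) IH _ hz dz) vE; lia.
Qed.

(** In degree [z] a generator of degree [d <= t] has a coefficient of positive degree [z - d]. This
    lies in the ideal of the [xs j], which kills cohomology. *)
Lemma cocycle_span_boundary t v (z : int) : t%:Z < z -> cocycle_span t v ->
  exists b, forall J : {set 'I_n}, piz (z + (\sum_(j in J) 1)%N%:Z) (v J) = koszul_d xs b J.
Proof.
move=> ltz; elim=> {v} [v v0|v w r c d _ [b bE] led hc dc vE].
  exists (fun=> 0) => J; rewrite v0 piz0 /koszul_d big1 // => j _.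
  by rewrite mulr0 mul0r.
have [|a aE] := @piz_irrelevant (z - d) r; first by lia.
exists (fun J => (\sum_j a j * koszul_homotopy j c J) + b J) => J.
rewrite koszul_dD koszul_d_linear -bE vE pizD; congr (_ + _).
have -> : z + (\sum_(j in J) 1)%N%:Z = (z - d) + (d + (\sum_(j in J) 1)%N%:Z).
  by rewrite addrA subrK.
rewrite (piz_mulr _ _ (hc J)) aE mulr_suml; apply: eq_bigr => j _.
by rewrite koszul_homotopyP // mulrA.
Qed.

Definition vanishing_above (k : 'I_n -> nat) (t : nat) : Prop :=
  forall (z : int) c, t%:Z < z -> homog_cochain k z c ->
    (forall J, koszul_d (fun j => xs j ^+ k j) c J = 0) ->
  exists2 b, homog_cochain k z b & forall J, c J = koszul_d (fun j => xs j ^+ k j) b J.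

Lemma homogz_xsX (k : 'I_n -> nat) j : homogz pi (k j) (xs j ^+ k j).
Proof. by have := homogzX (k j) (xs1 j : homogz pi 1 (xs j)); rewrite natz. Qed.

(* The cocycles form a finitely generated module and the Koszul cohomology is killed
   by the irrelevant ideal. *)
Lemma koszul_vanishing : exists t : nat, vanishing_above (fun=> 1%N) t.
Proof.
have noeth : noetherian A by case: sgA => _ [_ [_ [_ [_ [_ [_ [_ ]]]]]]].
have [N stab] := noetherian_submodule_chain noeth cocycle_span_submodule cocycle_spanS.
exists N => z c ltz hc dc; case: z => [z|//] in ltz hc *.
have Hc : cocycle_span N c.
  (* The cocycle [c] lies in the span at stage [z], hence already at stage [N]. *)
  apply: (stab z) => //; first by lia.
  apply: (@cocycle_spanD _ _ (fun=> 0) 1 c z) => //; first exact: cocycle_span0.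
  by move=> J; rewrite mul1r addr0.
have [b bE] := cocycle_span_boundary ltz Hc.
apply: (koszul_d_proj (b := b) (homogz_xsX (fun=> 1%N)) hc).
by move=> J; have /homogzE <- := hc J; rewrite bE.
Qed.

(** * Koszul cohomology of powers of the generators *)

Definition set_at (k : 'I_n -> nat) j m l : nat := if l == j then m else k l.

Lemma sum_set_at_in k j m (J : {set 'I_n}) : j \in J ->
  (\sum_(l in J) set_at k j m l = m + \sum_(l in J :\ j) k l)%N.
Proof.
move=> jJ; rewrite (sum_setD1 _ jJ) /set_at eqxx; congr (_ + _)%N.
by apply: eq_bigr => l; rewrite in_setD1 => /andP [/negPf -> _].
Qed.

Lemma sum_set_at_notin k j m (J : {set 'I_n}) : j \notin J ->
  (\sum_(l in J) set_at k j m l = \sum_(l in J) k l)%N.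
Proof.
move=> jJ; apply: eq_bigr => l lJ; rewrite /set_at ifF //.
by apply: contraNF jJ => /eqP <-.
Qed.

(* The mapping cone of the transition map from the Koszul complex on x_j^m to the one on
   x_j^(m+1) is quasi-isomorphic to the Koszul complex on x_j, shifted by m; the proof is
   the resulting exact sequence, written out on cochains. *)
Lemma vanishing_above_step k j m t : k j = m.+1 ->
    vanishing_above (set_at k j 1) t -> vanishing_above (set_at k j m) t ->
  vanishing_above k t.
Proof.
move=> kj V1 Vm z c ltz hc dc.
pose y1 l := xs l ^+ set_at k j 1 l; pose ym l := xs l ^+ set_at k j m l.
pose y l := xs l ^+ k l; rewrite -/y in dc *.
have y1E l : l != j -> y1 l = y l by rewrite /y1 /set_at => /negPf ->.
have ymE l : l != j -> ym l = y l by rewrite /ym /set_at => /negPf ->.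
have y1j : y1 j = xs j by rewrite /y1 /set_at eqxx expr1.
have ymj : ym j = xs j ^+ m by rewrite /ym /set_at eqxx.
have yj : y j = xs j ^+ m * xs j by rewrite /y kj exprSr.
have neqj (J : {set 'I_n}) l : j \notin J -> l \in J -> l != j.
  by move=> jJ lJ; apply: contraNneq jJ => <-.
(* The image of [c] under the chain map from the complex on [x_j^(m+1)] to the one on [x_j], of
   degree [m]. *)
pose c1 (J : {set 'I_n}) := if j \in J then c J else xs j ^+ m * c J.
have [|||b1 hb1 c1E] := V1 (z + m%:Z) c1.
- by lia.
- move=> J; rewrite /c1; case: ifPn => jJ.
    rewrite (sum_set_at_in _ _ jJ) -addrA -PoszD addnA addn1 -kj -sum_setD1 //.
  rewrite (sum_set_at_notin _ _ jJ) [z + m%:Z]addrC -addrA.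
  apply: homogzM (hc J); have := homogzX m (xs1 j : homogz pi 1 (xs j)).
  by rewrite natz.
- move=> J; rewrite -/y1; have [jJ|jJ] := boolP (j \in J).
    rewrite -[RHS](dc J) !(koszul_dD1 _ _ jJ) /c1 setD11 y1j yj; congr (_ + _).
      by ring.
    apply: eq_bigr => l /andP [lJ lj].
    by rewrite in_setD1 eq_sym lj jJ y1E.
  rewrite -[RHS](mulr0 (xs j ^+ m)) -(dc J) mulr_sumr; apply: eq_bigr => l lJ.
  rewrite /c1 in_setD1 (negPf jJ) andbF (y1E l) ?(neqj J) //; by ring.
(* Off [j], [b1] exhibits [x_j^m c] as a boundary; it therefore completes [c] to a cocycle for
   [x_j^m]. *)
pose cm (J : {set 'I_n}) := if j \in J then (-1) ^+ below_card j J * b1 (J :\ j) else c J.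
have [||bm _ cmE] := Vm z cm ltz.
- move=> J; rewrite /cm; case: ifPn => jJ; last first.
    by rewrite (sum_set_at_notin _ _ jJ); apply: hc.
  apply: homogz_sign; rewrite (sum_set_at_in _ _ jJ) PoszD addrA.
  by have := hb1 (J :\ j); rewrite sum_set_at_notin // setD11.
- move=> J; rewrite -/ym; have [jJ|jJ] := boolP (j \in J); last first.
    rewrite -(dc J); apply: eq_koszul_d => l lJ; first by rewrite ymE ?(neqj J).
    by rewrite /cm in_setD1 (negPf jJ) andbF.
  rewrite (koszul_dD1 _ _ jJ) {1}/cm setD11 ymj.
  have := c1E (J :\ j); rewrite /c1 setD11 -/y1 => E.
  rewrite -mulrA [c _ * _]mulrC E mulr_sumr.
  have -> : \sum_(l in J | l != j) (-1) ^+ below_card l J * cm (J :\ l) * ym l =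
      \sum_(l in J :\ j) - ((-1) ^+ below_card j J *
        ((-1) ^+ below_card l (J :\ j) * b1 (J :\ j :\ l) * y1 l)).
    apply: eq_big => [l|l /andP [lJ lj]]; first by rewrite in_setD1 andbC.
    rewrite /cm in_setD1 eq_sym lj jJ /= mulrA koszul_sign // ymE // y1E //.
    have -> : J :\ l :\ j = J :\ j :\ l by apply/setP => i; rewrite !inE andbCA.
    by ring.
  by rewrite sumrN subrr.
(* This primitive comes from substituting the expression of [b1 (J :\ j)] through [bm] into
   [c J = koszul_d y1 b1 J], for [j] in [J]. *)
apply: (@koszul_d_proj k y z c (fun J : {set 'I_n} =>
  if j \in J then b1 J + xs j * bm J else bm J)).
- exact: homogz_xsX.
- exact: hc.
move=> J; have := cmE J; have := c1E J; rewrite -/y1 -/ym /cm /c1.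
have [jJ|jJ] := boolP (j \in J) => E1 Em; last first.
  rewrite Em; apply: eq_koszul_d => l lJ; first by rewrite ymE ?(neqj J).
  by rewrite in_setD1 (negPf jJ) andbF.
move: E1 Em; rewrite !(koszul_dD1 _ _ jJ) setD11 y1j ymj yj.
set s := (-1) ^+ below_card j J => E1 Em.
have -> : \sum_(l in J | l != j) (-1) ^+ below_card l J *
      (if j \in J :\ l then b1 (J :\ l) + xs j * bm (J :\ l) else bm (J :\ l)) * y l =
    \sum_(l in J | l != j) (-1) ^+ below_card l J * b1 (J :\ l) * y1 l +
    xs j * \sum_(l in J | l != j) (-1) ^+ below_card l J * bm (J :\ l) * ym l.
  rewrite mulr_sumr -big_split; apply: eq_bigr => l /andP [lJ lj] /=.
  rewrite in_setD1 eq_sym lj jJ y1E // ymE //=; by ring.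
have -> : s * bm (J :\ j) * (xs j ^+ m * xs j) = xs j * (s * bm (J :\ j) * xs j ^+ m).
  by ring.
by rewrite addrCA -mulrDr -Em E1; ring.
Qed.

(** Induction on the sum of the exponents: replacing some [k j = m + 1 > 1] by [1] or by [m] lowers
    it. *)
Lemma vanishing_above_powers t (k : 'I_n -> nat) : vanishing_above (fun=> 1%N) t ->
  (forall j, (0 < k j)%N) -> vanishing_above k t.
Proof.
move=> V1; have [s] := ubnP (\sum_j k j)%N; elim: s k => // s IH k lts k_gt0.
have [/forallP k1|] := boolP [forall j, k j == 1%N].
  have kE j : k j = 1%N by apply/eqP.
  move=> z c ltz hc dc; have [||b hb cE] := V1 z c ltz.
  - by move=> J; have := hc J; under eq_bigr do rewrite kE.
  - by move=> J; rewrite -[RHS](dc J); apply: eq_koszul_d => // j _; rewrite kE.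
  exists b => J; first by have := hb J; under [in X in _ -> X]eq_bigr do rewrite kE.
  by rewrite cE; apply: eq_koszul_d => // j _; rewrite kE.
move=> /forallPn [j kj1]; have := k_gt0 j; case kj: (k j) kj1 => [//|m] m0 _.
have sumk : (\sum_l k l = m.+1 + \sum_(l in setT :\ j) k l)%N.
  by rewrite -kj -sum_setD1 ?in_setT //; apply: eq_bigl => l; rewrite in_setT.
have sums u : (\sum_l set_at k j u l = u + \sum_(l in setT :\ j) k l)%N.
  rewrite -(@sum_set_at_in k j u setT) ?in_setT //.
  by apply: eq_bigl => l; rewrite in_setT.
by apply: (vanishing_above_step kj); apply: IH => [|l]; rewrite ?sums /set_at;
  try case: ifP => _; rewrite ?k_gt0 //; lia.
Qed.

(** * Passage between Cech and Koszul cochains *)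

Lemma homogz_xJX (J : {set 'I_n}) m : homogz pi (m * #|J|)%N (xJ xs J ^+ m).
Proof.
have hJ : homogz pi #|J| (xJ xs J).
  have := homogz_prod (P := mem J) (fun j _ => xs1 j : homogz pi 1 (xs j)).
  by rewrite sumr_const natz.
by have := homogzX m hJ; rewrite -mulr_natr natz -PoszM mulnC.
Qed.

(** There are finitely many [J], so one power of the [x_J] makes all the local cocycle equations
    hold in the ring itself. *)
Lemma cech_cocycle_lift i alpha c k :
    cochain_homog pi i alpha c k -> cech_cocycle xs i c k ->
  exists m c0, let l := (k + m.+1)%N in
    [/\ homog_cochain (fun=> l) alpha c0,
        forall J, koszul_d (fun j => xs j ^+ l) c0 J = 0
      & forall J : {set 'I_n}, #|J| = i -> c0 J = xJ xs J ^+ m.+1 * c J].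
Proof.
move=> hc cc.
have /fin_all_exists [N NE] (J : {set 'I_n}) :
    exists N, #|J| = i.+1 -> xJ xs J ^+ N * cech_d_num xs c k J = 0.
  have [cJ|cJ] := eqVneq #|J| i.+1; last by exists 0%N => /eqP; rewrite (negPf cJ).
  by have [N NE] := cc J cJ; exists N => _; rewrite -NE mul0r subr0 mulr1.
pose m := \max_J N J.
(* The exponent [m.+1] keeps [l] positive even if [k] and [m] are zero. *)
pose c0 (J : {set 'I_n}) := if #|J| == i then xJ xs J ^+ m.+1 * c J else 0.
exists m, c0 => l; split=> [J|J|J /eqP cJ]; last by rewrite /c0 cJ.
  rewrite /c0; case: eqP => [cJ|_]; last exact: homogz0.
  have -> : alpha + (\sum_(j in J) l)%N%:Z =
      (m.+1 * #|J|)%N%:Z + (alpha + (k * i)%N%:Z).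
    by rewrite sum_nat_const cJ /l; lia.
  exact: homogzM (homogz_xJX _ _) (hc J cJ).
have [cJ|cJ] := eqVneq #|J| i.+1; last first.
  rewrite /koszul_d big1 // => j jJ; rewrite /c0 ifF ?mulr0 ?mul0r //.
  by apply: contraNF cJ => /eqP <-; rewrite (cardsD1 j) jJ.
have lt_m : (N J <= m.+1)%N by rewrite leqW // leq_bigmax.
rewrite -[RHS](mulr0 (xJ xs J ^+ (m.+1 - N J))) -(NE J cJ) mulrA -exprD subnK //.
rewrite mulr_sumr; apply: eq_bigr => j jJ.
have cJj : #|J :\ j| = i by move: cJ; rewrite (cardsD1 j) jJ => -[].
have -> : xJ xs J = xs j * xJ xs (J :\ j) by rewrite /xJ (big_setD1 j).
rewrite /c0 cJj eqxx /l exprD exprMn -/(below_card j J).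
move: (_ ^+ m.+1) (_ ^+ m.+1) (_ ^+ k) (_ ^+ below_card j J) (c _) => u v w x y; ring.
Qed.

Lemma koszul_cech_coboundary i alpha c k m b : let l := (k + m)%N in
    homog_cochain (fun=> l) alpha b ->
    (forall J : {set 'I_n}, #|J| = i ->
       xJ xs J ^+ m * c J = koszul_d (fun j => xs j ^+ l) b J) ->
  cech_coboundary pi xs i alpha c k.
Proof.
move=> l hb bE; case: i bE => [|i] bE /=.
  move=> J cJ; exists m; rewrite mul0r subr0 mulr1 bE //.
  by rewrite (cards0_eq cJ) /koszul_d big_set0.
exists b, l; split=> [J cJ|J cJ].
  by have := hb J; rewrite sum_nat_const cJ mulnC.
exists 0%N; rewrite -[cech_d_num _ _ _ _]bE // /l exprD; ring.
Qed.

(** * Frobenius and the splitting on Koszul cochains *)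

Section Frobenius.
Variables (p e : nat) (phi : A -> A) (f : A).
Hypotheses (charKp : p \in [pchar K]) (phi_lin : plinear p e phi) (phi_f : phi f = 1).
Let q := (p ^ e)%N.

Lemma exprDn_Frobenius (x y : A) : (x + y) ^+ q = x ^+ q + y ^+ q.
Proof.
apply: exprDn_pchar; rewrite /q pnatX pnatE ?(pcharf_prime charKp) //.
by rewrite inE (pcharf_prime charKp) -scaler_nat pcharf0 // scale0r eqxx.
Qed.

Lemma q_gt0 : (0 < q)%N.
Proof. by rewrite expn_gt0 prime_gt0 // (pcharf_prime charKp). Qed.

Lemma sum_Frobenius (I : Type) (s : seq I) (P : pred I) (F : I -> A) :
  (\sum_(i <- s | P i) F i) ^+ q = \sum_(i <- s | P i) F i ^+ q.
Proof.
elim/big_rec2: _ => [|i y1 y2 _ <-]; last exact: exprDn_Frobenius.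
by rewrite expr0n gtn_eqF ?q_gt0.
Qed.

Lemma sign_Frobenius m : ((-1) ^+ m) ^+ q = (-1) ^+ m :> A.
Proof.
have N1 : (-1) ^+ q = -1 :> A.
  apply/eqP; rewrite -addr_eq0 -{2}[1](expr1n A q) -exprDn_Frobenius addNr.
  by rewrite expr0n gtn_eqF ?q_gt0.
by rewrite exprAC N1.
Qed.

Lemma phi0 : phi 0 = 0.
Proof. by case: phi_lin => phiD _; apply: (addrI (phi 0)); rewrite -phiD !addr0. Qed.

(** Signs are their own [q]-th powers, so [phi] pulls out both the sign and [y j ^+ q]. *)
Lemma koszul_d_phi y b J :
  phi (koszul_d (fun j => y j ^+ q) b J) = koszul_d y (phi \o b) J.
Proof.
have [phiD phiM] := phi_lin.
have phi_sum (I : Type) (s : seq I) (P : pred I) (F : I -> A) :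
    phi (\sum_(i <- s | P i) F i) = \sum_(i <- s | P i) phi (F i).
  by elim/big_rec2: _ => [|i y1 y2 _ <-]; [exact: phi0 | exact: phiD].
rewrite phi_sum; apply: eq_bigr => j _; rewrite -sign_Frobenius.
rewrite mulrAC -exprMn phiM sign_Frobenius /=; ring.
Qed.

Lemma koszul_d_Frobenius y c J :
  koszul_d (fun j => y j ^+ q) (fun J' => c J' ^+ q) J = koszul_d y c J ^+ q.
Proof.
rewrite sum_Frobenius; apply: eq_bigr => j _.
by rewrite !exprMn sign_Frobenius.
Qed.

(** Stated for the components of [f], as [f] may be inhomogeneous. *)
Lemma homog_cochain_Frobenius l z c d : homog_cochain (fun=> l) z c ->
  homog_cochain (fun=> l * q)%N (z *+ q + d%:Z) (fun J => pi d f * c J ^+ q).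
Proof.
move=> hc J; have hd : homogz pi d (pi d f) by exact: (homogz_piz d).
have -> : z *+ q + d%:Z + (\sum_(j in J) l * q)%N%:Z =
    d%:Z + (z + (\sum_(j in J) l)%N%:Z) *+ q.
  rewrite mulrnDl addrCA addrA; congr (_ + _).
  by rewrite -big_distrl /= -[RHS]mulr_natr natz -PoszM.
by apply: homogzM hd _; apply: homogzX.
Qed.

(* The splitting [phi] of multiplication by [f] makes z |-> f F^e(z) injective on
   local cohomology, while all homogeneous components of f F^e(z) vanish for degree
   reasons. *)
Lemma cech_coboundary_of_splitting t s i alpha c k :
    vanishing_above (fun=> 1%N) t -> ideal_pow (irrelevant_ideal pi) s f ->
    t%:Z < alpha *+ q + s%:Z ->
    cochain_homog pi i alpha c k -> cech_cocycle xs i c k ->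
  cech_coboundary pi xs i alpha c k.
Proof.
move=> V1 fs ltt hc cc.
have [m [c0 [hc0 dc0 c0E]]] := cech_cocycle_lift hc cc.
set l := (k + m.+1)%N in hc0 dc0.
have V : vanishing_above (fun=> l * q)%N t.
  by apply: vanishing_above_powers V1 _ => _; rewrite muln_gt0 q_gt0 /l addnS.
have bd (d : nat) : exists b, forall J,
    pi d f * c0 J ^+ q = koszul_d (fun j => xs j ^+ (l * q)) b J.
  have [lt_ds|le_sd] := ltnP d s.
    exists (fun=> 0) => J; rewrite (ideal_pow_low_degree fs lt_ds) mul0r.
    by rewrite /koszul_d big1 // => j _; rewrite mulr0 mul0r.
  have [||b _ bE] := V _ _ _ (homog_cochain_Frobenius d hc0); last by exists b.
    by lia.
  move=> J; transitivity (pi d f * koszul_d (fun j => xs j ^+ l) c0 J ^+ q).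
    rewrite -koszul_d_Frobenius mulr_sumr; apply: eq_bigr => j _.
    rewrite exprM; ring.
  by rewrite dc0 expr0n gtn_eqF ?q_gt0 // mulr0.
have [N [_ fE]] := pi_decomp f.
have /fin_all_exists [b bE] (d : 'I_N) := bd d.
(* Summing over [d] makes [c0 ^+ q * f] a boundary, and [phi] sends it to [c0]. The factor [1] fits
   [koszul_d_linear]. *)
have c0b J : c0 J = koszul_d (fun j => xs j ^+ l) (phi \o (fun J' => \sum_d 1 * b d J')) J.
  rewrite -koszul_d_phi.
  have -> : koszul_d (fun j => (xs j ^+ l) ^+ q) (fun J' => \sum_d 1 * b d J') J =
      c0 J ^+ q * f.
    rewrite koszul_d_linear {1}fE mulr_sumr; apply: eq_bigr => d _.
    rewrite mul1r [RHS]mulrC bE; apply: eq_koszul_d => // j _.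
    by rewrite exprM.
  by case: phi_lin => _ phiM; rewrite phiM phi_f mulr1.
have [b' hb' b'E] := koszul_d_proj (homogz_xsX (fun=> l)) hc0 c0b.
by apply: (koszul_cech_coboundary hb') => J cJ; rewrite -b'E c0E.
Qed.

End Frobenius.

End Koszul.
End GradedRing.

(** * Choice of the Frobenius exponent and the bound on the threshold *)

Lemma expn_dominates (p : nat) (a b : R) (e0 : nat) : (1 < p)%N -> 0 < a ->
  exists2 e, (e0 <= e)%N & b < a * (p ^ e)%:R.
Proof.
move=> p_gt1 a_gt0; pose e := maxn e0 (Num.bound (`|b| / a)).
exists e; first exact: leq_maxl.
have : `|b| / a < (p ^ e)%:R.
  apply: lt_le_trans (archi_boundP _) _; first by rewrite divr_ge0 // ltW.
  rewrite ler_nat; apply: leq_trans (leq_maxr e0 _) (ltnW (ltn_expl _ p_gt1)).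
rewrite ltr_pdivrMr // mulrC; exact: le_lt_trans (ler_norm b).
Qed.

Theorem theorem4p3 (p : nat) (K : fieldType) (A : comAlgType K)
    (pi : nat -> A -> A) :
  prime p -> p \in [pchar K] ->
  standard_graded pi -> F_finite A p -> F_pure A p ->
  forall i : nat, (fpt pi p <= - a_inv pi i)%E.
Proof.
move=> p_pr charKp sgA _ _ i.
apply: ge_ereal_sup => _ [lam [lam_ge0 pure ->]].
rewrite leeNr; apply: ge_ereal_sup => _ [alpha [nz ->]].
rewrite -EFinN lee_fin leNgt; apply/negP => lt_alpha.
have [n [xs [xs1 [xs_span [c [k [hc [cc ncb]]]]]]]] := nz.
have [t V] := koszul_vanishing sgA xs1 xs_span.
have [e0 pure_e] := pure.
(* With [q = p ^ e], truncation gives [s > (q - 1) lam - 1], so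
   [q alpha + s > q (lam + alpha) - lam - 1], which must exceed [t]. *)
have [|e le_e lt_e] := @expn_dominates p (lam + alpha%:~R) (t%:R + lam + 1) e0 (prime_gt1 p_pr).
  by rewrite -ltrBlDl sub0r.
have [f [fs [phi [phi_lin phi_f]]]] := pure_e e le_e.
apply: ncb; apply: (cech_coboundary_of_splitting sgA xs1 charKp phi_lin phi_f V fs) => //.
rewrite -(ltr_int R) rmorphD /= rmorphMn /=.
have := truncnS_gt (((p ^ e)%:R - 1) * lam : R).
rewrite -natr1 -[_ *+ _]mulr_natr; lra.
Qed.
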